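(* Consider deterministic automata $G$ over finite event sets $E$ with uncontrollable events $E_{uc}\subseteq E$, metrics $d$ on $E$ with values in $[0,1]$, and $\lambda\in[0,1]$. For languages $K,K_1,K_2\subseteq L(G)$: (1) If $K$ is prefix closed, then so is $K^{\Uparrow}$. (2) If $K_1\subseteq K_2$, then $K_1^{\Uparrow}\subseteq K_2^{\Uparrow}$. (3) $(K_1\cap K_2)^{\Uparrow}\subseteq K_1^{\Uparrow}\cap K_2^{\Uparrow}$; this inclusion can be strict (i.e. it is strict for some choice of $G,E_{uc},d,\lambda,K_1,K_2$). (4) $K_1^{\Uparrow}\cup K_2^{\Uparrow}\subseteq(K_1\cup K_2)^{\Uparrow}$; this inclusion can be strict (i.e. it is strict for some choice of $G,E_{uc},d,\lambda,K_1,K_2$).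
   Context: Setting. $E$ is a finite set of events, partitioned as $E=E_c\sqcup E_{uc}$ (controllable / uncontrollable events); $E^*$ is the set of finite strings over $E$ including the empty string $\epsilon$; $l(s)$ is the length of a string $s$; $\overline{L}$ is the prefix closure of a language $L\subseteq E^*$. $G=(Q,E,\delta,q_0)$ is a deterministic automaton with partial transition function $\delta:Q\times E\to Q$, extended to strings as usual, and $L(G)=\{s\in E^*:\delta(q_0,s)\text{ is defined}\}$ (a prefix closed language containing $\epsilon$). Metrics. $d$ is a metric on $E$ with values in $[0,1]$. Set $d(\epsilon,\epsilon)=0$ and $d(a,\epsilon)=d(\epsilon,a)=1$ for $a\in E$. For strings $s=s_1\cdots s_{l(s)}$, $t=t_1\cdots t_{l(t)}$, pad the shorter one with $\epsilon$'s and define $d(s,t)=\sum_{i=1}^{\max\{l(s),l(t)\}}2^{-i}d(s_i,t_i)$. For a string $s$ and a language $A$, $d(s,A)=\inf_{a\in A}d(s,a)$ if $A\neq\emptyset$ and $d(s,\emptyset)=1$. For languages $A,B$, $d(A,B)$ is the Hausdorff metric: $d(\emptyset,\emptyset)=0$, and otherwise $d(A,B)=\max\{\sup_{a\in A}d(a,B),\sup_{b\in B}d(b,A)\}$ (a supremum over the empty set being $0$). Controllability. A language $K\subseteq L(G)$ is controllable if $\overline{K}E_{uc}\cap L(G)\subseteq\overline{K}$. A language $K\subseteq L(G)$ is $\lambda$-controllable if there is a controllable language $\widetilde K\subseteq L(G)$ with $d(\widetilde K,K)\le\lambda$. For $K\subseteq L(G)$, $K^{\Uparrow}$ denotes the supremal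 $\lambda$-controllable sublanguage of $K$, i.e. the union of all $\lambda$-controllable languages $M\subseteq K$ (it is itself $\lambda$-controllable). *)

(* Defs.v *)
From HB Require Import structures.
From mathcomp Require Import all_boot all_order all_algebra.
From mathcomp Require Import all_classical reals.

Set Implicit Arguments.
Unset Strict Implicit.
Unset Printing Implicit Defensive.

Import Order.TTheory GRing.Theory Num.Theory.

Local Open Scope classical_set_scope.
Local Open Scope ring_scope.

(* The state set may be infinite; [delta q a = None] means undefined. *)
Record automaton (E : finType) := Automaton {
  state : Type;
  delta : state -> E -> option state;
  init : state
}.

Fixpoint run (E : finType) (G : automaton E) (q : state G) (s : seq E)
    : option (state G) :=
  if s is a :: s' then obind (fun q' => run q' s') (delta q a) else Some q.

Definition lang (E : finType) (G : automaton E) : set (seq E) :=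
  [set s | run (init G) s <> None].

Definition prefix_closure (E : finType) (L : set (seq E)) : set (seq E) :=
  [set s | exists2 t, L t & prefix s t].

Definition prefix_closed (E : finType) (L : set (seq E)) : Prop :=
  prefix_closure L = L.

Record unit_metric (R : realType) (E : finType) (d : E -> E -> R) : Prop :=
  UnitMetric {
    unit_metric_range : forall a b, 0 <= d a b <= 1;
    unit_metric_eq0 : forall a b, d a b = 0 <-> a = b;
    unit_metric_sym : forall a b, d a b = d b a;
    unit_metric_triangle : forall a b c, d a c <= d a b + d b c
  }.

(* Extension of d to events and the empty string, the latter being [None]. *)
Definition event_dist (R : realType) (E : finType) (d : E -> E -> R)
    (x y : option E) : R :=
  match x, y with
  | Some a, Some b => d a b
  | None, None => 0
  | _, _ => 1
  end.

(* [onth s i] is [None] past the end of s, which is the padding by empty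
   strings; positions start at 0, hence the exponent i + 1. *)
Definition string_dist (R : realType) (E : finType) (d : E -> E -> R)
    (s t : seq E) : R :=
  \sum_(0 <= i < maxn (size s) (size t))
     2 ^- i.+1 * event_dist d (onth s i) (onth t i).

Definition string_lang_dist (R : realType) (E : finType) (d : E -> E -> R)
    (s : seq E) (A : set (seq E)) : R :=
  if `[< A = set0 >] then 1 else inf [set string_dist d s a | a in A].

(* [sup set0 = 0], so lang_dist d set0 set0 = 0; when d has values in [0, 1],
   all the sets involved are bounded by 0 and 1, so that the real-valued [sup]
   and [inf] are the true ones. *)
Definition lang_dist (R : realType) (E : finType) (d : E -> E -> R)
    (A B : set (seq E)) : R :=
  Num.max (sup [set string_lang_dist d a B | a in A])
          (sup [set string_lang_dist d b A | b in B]).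

(* The controllable events are the complement of Euc. *)
Definition controllable (E : finType) (G : automaton E) (Euc : set E)
    (K : set (seq E)) : Prop :=
  K `<=` lang G /\
  [set rcons s u | s in prefix_closure K & u in Euc] `&` lang G
    `<=` prefix_closure K.

Definition lambda_controllable (R : realType) (E : finType) (G : automaton E)
    (Euc : set E) (d : E -> E -> R) (lambda : R) (K : set (seq E)) : Prop :=
  K `<=` lang G /\
  exists Kt : set (seq E), controllable G Euc Kt /\ lang_dist d Kt K <= lambda.

Definition sup_lambda_controllable (R : realType) (E : finType)
    (G : automaton E) (Euc : set E) (d : E -> E -> R) (lambda : R)
    (K : set (seq E)) : set (seq E) :=
  \bigcup_(M in [set M | lambda_controllable G Euc d lambda M /\ M `<=` K]) M.

(* Main.v *)
(** Prefix closure of a λ-controllable M stays λ-controllable, with the prefix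
    closure of the controllable witness of M as witness: truncating two strings
    at the same length only drops terms of their distance.

    Both strict inclusions already occur for one uncontrollable event u,
    L(G) = u^* and λ = 0.  There any K such that every string is a prefix of an
    element of K is controllable, whereas {ε} is not λ-controllable, because a
    nonempty controllable language contains a nonempty string, at distance at
    least 1/2 from ε.  Part (3) uses u^(2n) and {ε} ∪ u^(2n+1), part (4) uses
    {ε} and its complement. *)

Require Import Defs.
From HB Require Import structures.
From mathcomp Require Import all_boot all_order all_algebra.
From mathcomp Require Import all_classical reals.

Set Implicit Arguments.
Unset Strict Implicit.
Unset Printing Implicit Defensive.

Import Order.TTheory GRing.Theory Num.Theory.

Local Open Scope classical_set_scope.
Local Open Scope ring_scope.

Lemma onth_take (T : Type) (n i : nat) (s : seq T) :
  (i < n)%N -> onth (take n s) i = onth s i.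
Proof. by elim: n i s => [|n IHn] [|i] [|x s] //=; apply: IHn. Qed.

Lemma sup_image_le (R : realType) (T : Type) (A : set T) (f : T -> R) (x : R) :
  0 <= x -> (forall a, A a -> f a <= x) -> sup [set f a | a in A] <= x.
Proof.
move=> x0 fx; have [->|/set0P A0] := eqVneq A set0.
  by rewrite image_set0 sup0.
apply: ge_sup; first exact: image_nonempty.
by move=> _ [a Aa <-]; apply: fx.
Qed.

(** * Prefix closure and controllability *)

Section PrefixClosure.
Context {E : finType}.
Implicit Types (K : set (seq E)) (G : automaton E) (Euc : set E).

Lemma sub_prefix_closure K : K `<=` prefix_closure K.
Proof. by move=> s Ks; exists s => //; apply: prefix_refl. Qed.

Lemma prefix_closure_id K : prefix_closure (prefix_closure K) = prefix_closure K.
Proof.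
apply/seteqP; split; last exact: sub_prefix_closure.
by move=> s [t [v Kv tv] st]; exists v => //; apply: prefix_trans tv.
Qed.

Lemma run_prefix G q s t : prefix s t -> run (G := G) q t <> None ->
  run q s <> None.
Proof.
move=> /prefixP[v ->]; elim: s q => [|a s IHs] q //=.
by case: (delta q a) => //= q'; apply: IHs.
Qed.

Lemma prefix_closure_sub_lang G K : K `<=` lang G ->
  prefix_closure K `<=` lang G.
Proof. by move=> KG s [t /KG Gt st]; apply: run_prefix st Gt. Qed.

(** The closure condition sees [K] only through its prefix closure, and prefix closure is
    idempotent. *)
Lemma controllable_prefix_closure G Euc K : controllable G Euc K ->
  controllable G Euc (prefix_closure K).
Proof.
move=> [KG cK]; split; first exact: prefix_closure_sub_lang.
by rewrite prefix_closure_id.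
Qed.

End PrefixClosure.

(** * Distances between strings and between languages *)

Section Distance.
Context {R : realType} {E : finType} {d : E -> E -> R}.
Hypothesis d_metric : unit_metric d.
Implicit Types (s t : seq E) (A B : set (seq E)).

Lemma event_dist_ge0 x y : 0 <= event_dist d x y.
Proof.
by case: x y => [a|] [b|] //=; case/andP: (unit_metric_range d_metric a b).
Qed.

Lemma event_dist_le1 x y : event_dist d x y <= 1.
Proof.
by case: x y => [a|] [b|] //=; case/andP: (unit_metric_range d_metric a b).
Qed.

Lemma string_dist_term_ge0 s t i :
  0 <= 2 ^- i.+1 * event_dist d (onth s i) (onth t i).
Proof. by rewrite mulr_ge0 ?event_dist_ge0 // invr_ge0 exprn_ge0. Qed.

Lemma string_dist_ge0 s t : 0 <= string_dist d s t.
Proof. by apply: sumr_ge0 => i _; apply: string_dist_term_ge0. Qed.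

(** The total weight of the first [n] positions; being at most 1, it bounds every string distance by
    1. *)
Lemma sum_half_powers (n : nat) :
  \sum_(0 <= i < n) 2 ^- i.+1 = 1 - 2 ^- n :> R.
Proof.
elim: n => [|n IHn]; first by rewrite big_geq // expr0 invr1 subrr.
rewrite big_nat_recr //= IHn -addrA; congr (_ + _).
have -> : 2 ^- n = 2 ^- n.+1 + 2 ^- n.+1 :> R.
  by rewrite exprS invfM mulrC -splitr.
by rewrite opprD addrNK.
Qed.

Lemma string_dist_le1 s t : string_dist d s t <= 1.
Proof.
apply: (@le_trans _ _ (\sum_(0 <= i < maxn (size s) (size t)) 2 ^- i.+1)).
  apply: ler_sum => i _.
  by rewrite ler_piMr ?event_dist_le1 // invr_ge0 exprn_ge0.
by rewrite sum_half_powers gerBl invr_ge0 exprn_ge0.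
Qed.

Lemma string_distxx s : string_dist d s s = 0.
Proof.
apply: big1 => i _; case: (onth s i) => [a|] /=; last by rewrite mulr0.
by have /(unit_metric_eq0 d_metric) -> := erefl a; rewrite mulr0.
Qed.

Lemma string_dist_take n s t :
  string_dist d (take n s) (take n t) <= string_dist d s t.
Proof.
rewrite /string_dist !size_take_min -minn_maxr.
set N := maxn (size s) (size t).
(* The truncated strings are compared on the first [minn n N] positions; the full sum is cut there,
   and its tail is nonnegative. *)
rewrite (big_cat_nat (leq0n _) (geq_minr n N)) /=.
rewrite -[X in X <= _]addr0 lerD ?sumr_ge0 //; last first.
  by move=> i _; apply: string_dist_term_ge0.
rewrite le_eqVlt; apply/predU1P; left; apply: eq_big_nat => i /andP[_].
by rewrite leq_min => /andP[lt_in _]; rewrite !onth_take.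
Qed.

(** The first event of [s] faces padding, at distance 1, and the first position has weight 1/2. *)
Lemma string_dist_nil_ge s : s != [::] -> 2^-1 <= string_dist d s [::].
Proof.
case: s => // a s _; rewrite /string_dist maxn0 big_nat_recl //=.
rewrite expr1 mulr1 lerDl sumr_ge0 // => i _.
exact: (string_dist_term_ge0 (a :: s) [::] i.+1).
Qed.

Lemma string_lang_dist_le s t A : A t ->
  string_lang_dist d s A <= string_dist d s t.
Proof.
move=> At; rewrite /string_lang_dist; case: asboolP => [A0|_].
  by move: At; rewrite A0.
apply: ge_inf; last by exists t.
by exists 0 => _ [v _ <-]; apply: string_dist_ge0.
Qed.

(** The bound [x <= 1] covers empty [A], where the distance is 1 by convention. *)
Lemma string_lang_dist_ge s A x : x <= 1 ->
  (forall t, A t -> x <= string_dist d s t) -> x <= string_lang_dist d s A.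
Proof.
move=> x1 xA; rewrite /string_lang_dist; case: asboolP => // /eqP/set0P A0.
apply: lb_le_inf; first exact: image_nonempty.
by move=> _ [t At <-]; apply: xA.
Qed.

Lemma string_lang_dist_set0 s : string_lang_dist d s set0 = 1.
Proof. by rewrite /string_lang_dist; case: asboolP. Qed.

Lemma string_lang_dist_le1 s A : string_lang_dist d s A <= 1.
Proof.
have [->|/set0P[t At]] := eqVneq A set0; first by rewrite string_lang_dist_set0.
exact: le_trans (string_lang_dist_le s At) (string_dist_le1 s t).
Qed.

(** Replaces the suprema by pointwise bounds. Nonnegativity of [x] handles an empty language, whose
    supremum is 0. *)
Lemma lang_distP A B x : 0 <= x ->
  lang_dist d A B <= x <->
  (forall a, A a -> string_lang_dist d a B <= x) /\
  (forall b, B b -> string_lang_dist d b A <= x).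
Proof.
move=> x0; rewrite /lang_dist ge_max; split=> [/andP[]|[AB BA]]; last first.
  by apply/andP; split; apply: sup_image_le.
(* A real-valued [sup] is an upper bound only for sets bounded above; here 1 is a bound. *)
have le_sup C D c : C c ->
    string_lang_dist d c D <= sup [set string_lang_dist d a D | a in C].
  move=> Cc; apply: ub_le_sup; last by exists c.
  by exists 1 => _ [a _ <-]; apply: string_lang_dist_le1.
by move=> Ax Bx; split=> s /le_sup le_s; apply: le_trans (le_s _) _.
Qed.

(** Cutting any [v] in [A] to the length of [s] gives an element of the prefix closure no farther
    from [s] than [v] is from [t]. *)
Lemma string_lang_dist_prefix s t A : prefix s t ->
  string_lang_dist d s (prefix_closure A) <= string_lang_dist d t A.
Proof.
rewrite prefixE => /eqP <-; set n := size s.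
have [->|/set0P A0] := eqVneq A set0.
  by rewrite string_lang_dist_set0 string_lang_dist_le1.
apply: string_lang_dist_ge => [|v Av]; first exact: string_lang_dist_le1.
apply: le_trans (string_dist_take n t v).
by apply: string_lang_dist_le; exists v => //; apply: prefix_take.
Qed.

Lemma lang_dist_prefix_closure A B x : 0 <= x -> lang_dist d A B <= x ->
  lang_dist d (prefix_closure A) (prefix_closure B) <= x.
Proof.
move=> x0 /(lang_distP _ _ x0)[AB BA]; apply/lang_distP => //.
split=> s [t Ct st]; apply: le_trans (string_lang_dist_prefix _ st) _.
  exact: AB.
exact: BA.
Qed.

Lemma lang_distxx_le0 A : lang_dist d A A <= 0.
Proof.
have AA s : A s -> string_lang_dist d s A <= 0.
  by move=> /(string_lang_dist_le s); rewrite string_distxx.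
by apply/lang_distP.
Qed.

End Distance.

(** * The supremal λ-controllable sublanguage *)

Section Supremal.
Context {R : realType} {E : finType} {G : automaton E} {Euc : set E}.
Context {d : E -> E -> R} {lambda : R}.
Hypothesis d_metric : unit_metric d.
Implicit Types K : set (seq E).
Local Notation up := (sup_lambda_controllable G Euc d lambda).

Lemma sup_lambda_controllable_sub K : up K `<=` K.
Proof. by move=> s [M [_ MK] /MK]. Qed.

Lemma sup_lambda_controllableS K1 K2 : K1 `<=` K2 -> up K1 `<=` up K2.
Proof.
by move=> K12 s [M [cM MK] Ms]; exists M => //; split=> // t /MK /K12.
Qed.

Lemma lambda_controllable_prefix_closure K : 0 <= lambda ->
  lambda_controllable G Euc d lambda K ->
  lambda_controllable G Euc d lambda (prefix_closure K).
Proof.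
move=> lambda0 [KG [Kt [cKt dKt]]].
split; first exact: prefix_closure_sub_lang.
exists (prefix_closure Kt); split; first exact: controllable_prefix_closure.
exact: lang_dist_prefix_closure.
Qed.

Lemma sup_lambda_controllable_prefix_closed K : 0 <= lambda ->
  prefix_closed K -> prefix_closed (up K).
Proof.
move=> lambda0 Kcl; apply/seteqP; split; last exact: sub_prefix_closure.
(* The prefix closure of [M] contains [s] and stays inside [K] because [K] is prefix closed. *)
move=> s [t [M [cM MK] Mt] st]; exists (prefix_closure M); last by exists t.
split; first exact: lambda_controllable_prefix_closure.
by rewrite -Kcl => v [w /MK Kw vw]; exists w.
Qed.

Lemma controllable_sup_id K : 0 <= lambda -> controllable G Euc K -> up K = K.
Proof.
move=> lambda0 cK; apply/seteqP; split; first exact: sup_lambda_controllable_sub.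
move=> s Ks; exists K => //; split=> //; split; first by case: cK.
by exists K; split=> //; apply: le_trans lambda0; apply: lang_distxx_le0.
Qed.

Lemma nil_notin_sup_nil u : Euc u -> lang G [:: u] -> lambda < 2^-1 ->
  ~ up [set [::]] [::].
Proof.
move=> Eu Gu lambda_lt [M [[MG [Kt [[KtG cKt] dKt]]] Mnil] M0].
have ME : M = [set [::]] by apply/seteqP; split=> // s ->.
have half_le1 : 2^-1 <= 1 :> R by rewrite invf_le1 ?ltr0n // ler1n.
suff : 2^-1 <= lang_dist d Kt M by move=> /le_trans/(_ dKt); rewrite leNgt lambda_lt.
(* Needed to apply [lang_distP] with the distance itself as bound; it dominates the distance from ε
   to [Kt]. *)
have dist0 : 0 <= lang_dist d Kt M.
  rewrite /lang_dist le_max; apply/orP; right; rewrite ME image_set1 sup1.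
  by apply: string_lang_dist_ge => // t _; apply: string_dist_ge0.
have [dKtM dMKt] := (lang_distP d_metric Kt M dist0).1 (lexx _).
(* An empty [Kt] is at distance 1 from ε. Otherwise ε is a prefix of some element of [Kt], so
   controllability makes [[:: u]] a prefix of some [v] in [Kt], which is thus nonempty. *)
have [Kt0|/set0P[t Ktt]] := eqVneq Kt set0.
  by apply: le_trans (dMKt _ M0); rewrite Kt0 string_lang_dist_set0.
have [] := cKt [:: u].
  split=> //; exists [::]; first by exists t => //; rewrite prefix0s.
  by exists u.
move=> v Ktv uv; apply: le_trans (dKtM v Ktv); rewrite ME.
apply: string_lang_dist_ge => // _ ->; apply: string_dist_nil_ge => //.
by case: v uv {Ktv}.
Qed.

End Supremal.

(** * The one-event automaton and the strict inclusions *)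

Definition unit_clock : automaton unit :=
  @Automaton unit unit (fun q _ => Some q) tt.

Lemma lang_unit_clock : lang unit_clock = setT.
Proof.
apply/seteqP; split=> // s _; rewrite /lang /=.
by move: tt; elim: s => [|a s IHs] q //=; apply: IHs.
Qed.

Lemma unit_metric0 (R : realType) : unit_metric (fun _ _ : unit => 0 : R).
Proof.
split=> [_ _|[] []|//|_ _ _] //; last by rewrite addr0.
by rewrite lexx ler01.
Qed.

Section Clock.
Context {R : realType}.
Local Notation up := (sup_lambda_controllable unit_clock setT (fun _ _ => 0 : R) 0).

(** The hypothesis says that the prefix closure is the whole language, so no event can leave it. *)
Lemma clock_dense_sup_id K :
  (forall s, exists2 t, K t & prefix s t) -> up K = K.
Proof.
move=> dense; apply: controllable_sup_id => //; first exact: unit_metric0.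
split; first by rewrite lang_unit_clock.
by move=> s _; apply: dense.
Qed.

Lemma clock_nil_notin_sup_nil : ~ up [set [::]] [::].
Proof.
apply: (@nil_notin_sup_nil _ _ _ _ _ _ (unit_metric0 R) tt) => //.
by rewrite invr_gt0 ltr0n.
Qed.

Lemma clock_sup_setI_strict (K1 := [set s : seq unit | ~~ odd (size s)])
    (K2 := [set s : seq unit | s = [::] \/ odd (size s)]) :
  up (K1 `&` K2) `<` up K1 `&` up K2.
Proof.
have upK1 : up K1 = K1.
  apply: clock_dense_sup_id => s; case odds: (odd (size s)).
    (* One more event corrects the parity. *)
    by exists (rcons s tt); rewrite /K1 /= ?size_rcons /= ?odds ?prefix_rcons.
  by exists s; rewrite /K1 /= ?odds ?prefix_refl.
have upK2 : up K2 = K2.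
  apply: clock_dense_sup_id => s; case odds: (odd (size s)).
    by exists s; [right; rewrite odds | exact: prefix_refl].
  by exists (rcons s tt); [right; rewrite size_rcons /= odds | exact: prefix_rcons].
(* ε was added to the odd lengths so that the intersection is {ε}: then ε lies in the right-hand
   side but not in the left. *)
have -> : K1 `&` K2 = [set [::]] :> set (seq unit).
  apply/seteqP; split=> [s [/= /negP K1s []]|_ ->] //.
  by split=> //; left.
rewrite upK1 upK2; split.
  move=> s /sup_lambda_controllable_sub ->; split=> //; exact: or_introl.
by move=> /(_ [::]) up0; apply: clock_nil_notin_sup_nil; apply: up0; split=> //; left.
Qed.

Lemma clock_sup_setU_strict (K1 := [set [::] : seq unit]) :
  up K1 `|` up (~` K1) `<` up (K1 `|` ~` K1).
Proof.
rewrite setUv (@clock_dense_sup_id setT); last by move=> s; exists s => //; apply: prefix_refl.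
(* ε separates the two sides: the first operand loses it, and the second lies in the complement of
   {ε}. *)
split=> // /(_ [::] I)[/clock_nil_notin_sup_nil //|].
by move=> /sup_lambda_controllable_sub; apply.
Qed.

End Clock.

Theorem proposition4 (R : realType) :
  (forall (E : finType) (G : automaton E) (Euc : set E) (d : E -> E -> R)
          (lambda : R),
      unit_metric d -> 0 <= lambda <= 1 ->
      let up := sup_lambda_controllable G Euc d lambda in
      [/\ (forall K : set (seq E), K `<=` lang G ->
             prefix_closed K -> prefix_closed (up K)),
          (forall K1 K2 : set (seq E), K1 `<=` lang G -> K2 `<=` lang G ->
             K1 `<=` K2 -> up K1 `<=` up K2),
          (forall K1 K2 : set (seq E), K1 `<=` lang G -> K2 `<=` lang G ->
             up (K1 `&` K2) `<=` up K1 `&` up K2) &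
          (forall K1 K2 : set (seq E), K1 `<=` lang G -> K2 `<=` lang G ->
             up K1 `|` up K2 `<=` up (K1 `|` K2))]) /\
  (exists (E : finType) (G : automaton E) (Euc : set E) (d : E -> E -> R)
          (lambda : R) (K1 K2 : set (seq E)),
      let up := sup_lambda_controllable G Euc d lambda in
      [/\ unit_metric d, 0 <= lambda <= 1, K1 `<=` lang G, K2 `<=` lang G &
          up (K1 `&` K2) `<` up K1 `&` up K2]) /\
  (exists (E : finType) (G : automaton E) (Euc : set E) (d : E -> E -> R)
          (lambda : R) (K1 K2 : set (seq E)),
      let up := sup_lambda_controllable G Euc d lambda in
      [/\ unit_metric d, 0 <= lambda <= 1, K1 `<=` lang G, K2 `<=` lang G &
          up K1 `|` up K2 `<` up (K1 `|` K2)]).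
Proof.
split; last split.
- move=> E G Euc d lambda d_metric /andP[lambda0 _] up; split.
  + by move=> K _; apply: sup_lambda_controllable_prefix_closed.
  + by move=> K1 K2 _ _; apply: sup_lambda_controllableS.
  + move=> K1 K2 _ _; rewrite subsetI.
    by split; apply: sup_lambda_controllableS => s [].
  + move=> K1 K2 _ _; rewrite subUset.
    by split; apply: sup_lambda_controllableS => s; [left|right].
- exists unit, unit_clock, setT, (fun _ _ => 0), 0.
  exists [set s | ~~ odd (size s)], [set s | s = [::] \/ odd (size s)] => up.
  split; rewrite ?lang_unit_clock ?lexx ?ler01 //; first exact: unit_metric0.
  exact: clock_sup_setI_strict.
- exists unit, unit_clock, setT, (fun _ _ => 0), 0, [set [::]], (~` [set [::]]).
  move=> up.
  split; rewrite ?lang_unit_clock ?lexx ?ler01 //; first exact: unit_metric0.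
  exact: clock_sup_setU_strict.
Qed.
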